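(* Let $A$ and $B$ be two non-empty closed subsets of a complete metric space $(X,d)$, and let $F : X \times X \to X$ be a $(\phi,\psi)$-contraction type coupling with respect to $A$ and $B$, i.e. $F$ is a coupling with respect to $A$ and $B$ and there exist altering distance functions $\psi, \phi$ such that $$\psi\big(d(F(x,y),F(u,v))\big) \leq \psi\big(\max\{d(x,u),d(y,v)\}\big) - \phi\big(\max\{d(x,u),d(y,v)\}\big)$$ for all $x, v \in A$ and $y, u \in B$. Then: (i) $A \cap B \neq \emptyset$; (ii) $F$ has a unique strong coupled fixed point in $A \cap B$, i.e. there is exactly one $x \in A \cap B$ with $F(x,x) = x$.
   Context: Coupling: for non-empty subsets $A, B$ of a metric space $(X,d)$, a map $F : X \times X \to X$ is a coupling with respect to $A$ and $B$ if $F(x,y) \in B$ and $F(y,x) \in A$ whenever $x \in A$ and $y \in B$. Altering distance function: a function $\psi : [0,\infty) \to [0,\infty)$ that is monotone increasing (in the sense of non-decreasing) and continuous, and satisfies $\psi(t) = 0$ if and only if $t = 0$. Strong coupled fixed point: $(x,y) \in X \times X$ is a coupled fixed point of $F$ if $F(x,y) = x$ and $F(y,x) = y$; it is a strong coupled fixed point if moreover $x = y$, that is, $F(x,x) = x$ (one then also calls $x$ itself the strong coupled fixed point). *)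

(* Defs.v *)
From HB Require Import structures.
From mathcomp Require Import all_boot all_order all_algebra.
From mathcomp Require Import all_classical all_reals all_analysis.

Set Implicit Arguments.
Unset Strict Implicit.
Unset Printing Implicit Defensive.

Import Order.TTheory GRing.Theory Num.Theory.
Import numFieldNormedType.Exports.

Local Open Scope classical_set_scope.
Local Open Scope ring_scope.

(* [Complete] carries a base point, so the empty metric space is excluded. *)
#[short(type="completeMetricType")]
HB.structure Definition CompleteMetric (R : numDomainType) :=
  { T of Complete T & Metric R T }.

(* A function [0, oo[ -> [0, oo[ is encoded as a total function on R whose
   values outside [0, oo[ are irrelevant. *)
Definition altering_distance (R : realType) (psi : R -> R) : Prop :=
  [/\ {in `[0, +oo[, forall t, 0 <= psi t},
      {in `[0, +oo[ &, {homo psi : s t / s <= t}},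
      {within `[0, +oo[, continuous psi} &
      {in `[0, +oo[, forall t, psi t = 0 <-> t = 0}].

Definition coupling (X : Type) (A B : set X) (F : X -> X -> X) : Prop :=
  forall x y, A x -> B y -> B (F x y) /\ A (F y x).

Definition contraction_type_coupling (R : realType) (X : metricType R)
    (A B : set X) (F : X -> X -> X) : Prop :=
  coupling A B F /\
  exists psi phi : R -> R,
    [/\ altering_distance psi, altering_distance phi &
        forall x y u v : X, A x -> B y -> B u -> A v ->
          psi (mdist (F x y) (F u v)) <=
            psi (Num.max (mdist x u) (mdist y v))
            - phi (Num.max (mdist x u) (mdist y v))].

Definition coupled_fixed_point (X : Type) (F : X -> X -> X) (x y : X) : Prop :=
  F x y = x /\ F y x = y.

(* A strong coupled fixed point (x, x) is identified with x. *)
Definition strong_coupled_fixed_point (X : Type) (F : X -> X -> X) (x : X)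
    : Prop :=
  coupled_fixed_point F x x.

(* Main.v *)
Require Import Defs.
From mathcomp Require Import all_boot all_order all_algebra.
From mathcomp Require Import all_classical all_reals all_analysis.
From mathcomp Require Import lra.

(** Read on the pair (x, y) of A * B, the coupling becomes the self-map
    T (x, y) = (F y x, F x y) of A * B.  The contraction hypothesis does not
    compare T p with T q in the product metric, but in the crossed gauge
    rho p q = max (d p.1 q.2) (d p.2 q.1), the distance from p to the swap of
    q: it says that t = rho p q and r = rho (T p) (T q) satisfy
    psi r <= psi t - phi t ([cross_contraction]).

    Everything about the two altering functions that the convergence of the
    orbits needs is contained in two consequences of psi r <= psi t - phi t: first r <= t
    ([weak_contraction_le]), and second the uniform Meir-Keeler property, that
    for every e > 0 some delta > 0 has t < e + delta imply r < e
    ([weak_contraction_meir_keeler]).  The latter holds because phi e > 0 and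
    psi is continuous at e, so that psi t - phi t drops below psi e for t
    slightly above e.

    Take an orbit p_n = (x_n, y_n) of T in A * B.  By Meir-Keeler,
    rho p_n p_n = d x_n y_n and rho p_n p_(n+1) both tend to 0, since
    the limit of such a nonincreasing sequence cannot be positive
    ([weak_contraction_cvg0]).  Meir-Keeler then bounds rho p_N p_(N+k) uniformly
    in k ([cross_orbit_bound]), so that x_n is Cauchy.  Its limit x lies in A;
    it is also the limit of y_n, hence lies in B.  Passing to the limit in
    d (F x x) (F y_n x_n) <= max (d x y_n) (d x x_n) gives F x x = x.  For two
    fixed points u, v in the intersection of A and B, the hypothesis with
    t = r = d u v forces phi (d u v) <= 0, that is u = v. *)

Set Implicit Arguments.
Unset Strict Implicit.
Unset Printing Implicit Defensive.

Import Order.TTheory GRing.Theory Num.Theory.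
Import numFieldNormedType.Exports.

Local Open Scope classical_set_scope.
Local Open Scope ring_scope.

(** * Altering distance functions *)

Lemma altering_ge0 (R : realType) (psi : R -> R) (t : R) :
  altering_distance psi -> 0 <= t -> 0 <= psi t.
Proof. by case=> psi_ge0 _ _ _ t0; apply: psi_ge0; rewrite /= in_itv /= t0. Qed.

Lemma altering_homo (R : realType) (psi : R -> R) (s t : R) :
  altering_distance psi -> 0 <= s -> s <= t -> psi s <= psi t.
Proof.
case=> _ psi_homo _ _ s0 st.
by apply: psi_homo => //; rewrite /= in_itv /= ?s0 ?(le_trans s0 st).
Qed.

Lemma altering_eq0 (R : realType) (psi : R -> R) (t : R) :
  altering_distance psi -> 0 <= t -> psi t = 0 <-> t = 0.
Proof. by case=> _ _ _ psi_eq0 t0; apply: psi_eq0; rewrite /= in_itv /= t0. Qed.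

Lemma altering_gt0 (R : realType) (psi : R -> R) (t : R) :
  altering_distance psi -> 0 < t -> 0 < psi t.
Proof.
move=> psiP t0; rewrite lt_neqAle altering_ge0 ?ltW// andbT eq_sym.
apply/eqP => /(altering_eq0 psiP (ltW t0)) te0.
by rewrite te0 ltxx in t0.
Qed.

Lemma altering_continuous (R : realType) (psi : R -> R) (t : R) :
  altering_distance psi -> 0 < t -> {for t, continuous psi}.
Proof.
case=> _ _ /continuous_within_itvcyP[psi_cont _] _ t0.
by apply: psi_cont; rewrite /= in_itv /= t0.
Qed.

(** * Weak contractions of nonnegative numbers *)

(** Only monotonicity is available, so r > t does not contradict
    psi r <= psi t directly; it forces phi t = 0, and then t = 0 and r = 0. *)
Lemma weak_contraction_le (R : realType) (psi phi : R -> R) (t r : R) :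
  altering_distance psi -> altering_distance phi -> 0 <= t -> 0 <= r ->
  psi r <= psi t - phi t -> r <= t.
Proof.
move=> psiP phiP t0 r0 rt; rewrite leNgt; apply/negP => tr.
have psi_tr := altering_homo psiP t0 (ltW tr).
have phit_ge0 := altering_ge0 phiP t0.
have /(altering_eq0 phiP t0) te0 : phi t = 0 by lra.
have psit0 : psi t = 0 by apply/(altering_eq0 psiP t0).
have psir_ge0 := altering_ge0 psiP r0.
have /(altering_eq0 psiP r0) re0 : psi r = 0 by lra.
by rewrite te0 re0 ltxx in tr.
Qed.

(** Below e this is [weak_contraction_le]; from e on, phi t >= phi e while, by
    continuity at e, psi t < psi e + phi e, hence psi r < psi e. *)
Lemma weak_contraction_meir_keeler (R : realType) (psi phi : R -> R) (e : R) :
  altering_distance psi -> altering_distance phi -> 0 < e ->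
  exists2 delta, 0 < delta &
    forall t r, 0 <= t -> 0 <= r -> t < e + delta ->
      psi r <= psi t - phi t -> r < e.
Proof.
move=> psiP phiP e0; have phie := altering_gt0 phiP e0.
have : \forall t \near e, `|psi e - psi t| < phi e.
  by have /cvgrPdist_lt := altering_continuous psiP e0; apply.
case/nbhs_ballP => delta /= delta0 ball_delta.
exists delta => // t r t0 r0 te rt.
have [te'|et] := ltP t e.
  exact: le_lt_trans (weak_contraction_le psiP phiP t0 r0 rt) te'.
rewrite ltNge; apply/negP => er.
have psi_er := altering_homo psiP (ltW e0) er.
have phi_et := altering_homo phiP (ltW e0) et.
have /ball_delta /= : ball e delta t.
  by rewrite /ball /= distrC ger0_norm; lra.
by rewrite ltr_norml => /andP[psi_te _]; lra.
Qed.

(** A positive limit L would, by Meir-Keeler at L, be passed by the sequence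
    one step after coming close enough to it. *)
Lemma weak_contraction_cvg0 (R : realType) (psi phi : R -> R) (t : nat -> R) :
  altering_distance psi -> altering_distance phi -> (forall n, 0 <= t n) ->
  (forall n, psi (t n.+1) <= psi (t n) - phi (t n)) ->
  t n @[n --> \oo] --> 0.
Proof.
move=> psiP phiP t0 tS.
have t_noninc : nonincreasing_seq t.
  by apply/nonincreasing_seqP => n; apply: weak_contraction_le (tS n).
have t_cvg : cvgn t.
  by apply: nonincreasing_is_cvgn => //; exists 0 => _ [n _ <-].
have lim0 : 0 <= limn t by apply: limr_ge => //; apply: nearW.
suff lim_eq0 : limn t = 0 by rewrite -lim_eq0.
apply/eqP; rewrite eq_le lim0 andbT leNgt; apply/negP => lim_gt0.
have [delta delta0 mk] := weak_contraction_meir_keeler psiP phiP lim_gt0.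
have /cvgrPdist_lt/(_ _ delta0)[N _ /(_ N (leqnn N))] := t_cvg.
rewrite /= ltr_norml => /andP[tN _].
have tNS : t N.+1 < limn t by apply: mk (tS N) => //; lra.
by have := nonincreasing_cvgn_ge t_noninc t_cvg N.+1; rewrite leNgt tNS.
Qed.

(** * The crossed gauge on pairs and the orbits of a coupling *)

(** The distance from p to the swap of q: it compares points of A with points
    of B, as the contraction hypothesis does. *)
Definition cross_dist (R : realType) (X : metricType R) (p q : X * X) : R :=
  Num.max (mdist p.1 q.2) (mdist p.2 q.1).

(** The coordinates are arranged so that A * B is stable under a coupling. *)
Definition coupling_step (X : Type) (F : X -> X -> X) (p : X * X) : X * X :=
  (F p.2 p.1, F p.1 p.2).

Definition coupling_orbit (X : Type) (F : X -> X -> X) (p : X * X) (n : nat)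
    : X * X :=
  iter n (coupling_step F) p.

Lemma cross_dist_ge0 (R : realType) (X : metricType R) (p q : X * X) :
  0 <= cross_dist p q.
Proof. by rewrite le_max mdist_ge0. Qed.

(** The middle term replaces the vanishing self-distance of a metric: the two
    crossings through q arrive at opposite coordinates of q. *)
Lemma cross_dist_triangle (R : realType) (X : metricType R) (p q s : X * X) :
  cross_dist p s <= cross_dist p q + cross_dist q q + cross_dist q s.
Proof.
have le1 (u v : X * X) : mdist u.1 v.2 <= cross_dist u v.
  by rewrite le_max lexx.
have le2 (u v : X * X) : mdist u.2 v.1 <= cross_dist u v.
  by rewrite le_max lexx orbT.
rewrite ge_max; apply/andP; split.
- have := metric_triangle p.1 q.2 s.2; have := metric_triangle q.2 q.1 s.2.
  by have := le1 p q; have := le2 q q; have := le1 q s; lra.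
- have := metric_triangle p.2 q.1 s.1; have := metric_triangle q.1 q.2 s.1.
  by have := le2 p q; have := le1 q q; have := le2 q s; lra.
Qed.

Lemma coupling_orbit_in (X : Type) (A B : set X) (F : X -> X -> X)
    (p : X * X) (n : nat) :
  coupling A B F -> A p.1 -> B p.2 ->
  A (coupling_orbit F p n).1 /\ B (coupling_orbit F p n).2.
Proof.
move=> FAB pA pB; elim: n => [//|n [nA nB]] /=.
by have [] := FAB _ _ nA nB.
Qed.

Lemma cross_contraction (R : realType) (X : metricType R) (A B : set X)
    (F : X -> X -> X) (psi phi : R -> R) (p q : X * X) :
  (forall x y u v : X, A x -> B y -> B u -> A v ->
    psi (mdist (F x y) (F u v)) <=
      psi (Num.max (mdist x u) (mdist y v))
      - phi (Num.max (mdist x u) (mdist y v))) ->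
  A p.1 -> B p.2 -> A q.1 -> B q.2 ->
  psi (cross_dist (coupling_step F p) (coupling_step F q)) <=
    psi (cross_dist p q) - phi (cross_dist p q).
Proof.
move=> Fpsi pA pB qA qB; rewrite {1}/cross_dist maxEle /=.
case: ifP => _; first exact: (Fpsi p.1 p.2 q.2 q.1).
have := Fpsi q.1 q.2 p.2 p.1 qA qB pB pA.
rewrite maxC (metric_sym (F q.1 q.2)) (metric_sym q.1) (metric_sym q.2).
exact.
Qed.

(** * Convergence of the orbits *)

(** Induction on k: if rho p_N p_(N+k) < e / 2 + delta, then Meir-Keeler gives
    rho p_(N+1) p_(N+k+1) < e / 2, and going back from p_(N+1) to p_N costs
    less than delta once N is large.  Taking delta <= e / 2 keeps the bound
    below e. *)
Lemma cross_orbit_bound (R : realType) (X : metricType R) (psi phi : R -> R)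
    (p : nat -> X * X) (e : R) :
  altering_distance psi -> altering_distance phi ->
  (forall m n, psi (cross_dist (p m.+1) (p n.+1)) <=
    psi (cross_dist (p m) (p n)) - phi (cross_dist (p m) (p n))) ->
  0 < e ->
  exists N, forall k, cross_dist (p N) (p (N + k)%N) < e.
Proof.
move=> psiP phiP pS e0; have he0 : 0 < e / 2 by lra.
have [d0 d0_gt0 mk0] := weak_contraction_meir_keeler psiP phiP he0.
pose delta := Num.min d0 (e / 2).
have delta0 : 0 < delta by rewrite lt_min d0_gt0.
have delta_d0 : delta <= d0 by rewrite ge_min lexx.
have delta_e : delta <= e / 2 by rewrite ge_min lexx orbT.
have hdelta0 : 0 < delta / 2 by lra.
have diag0 : cross_dist (p n) (p n) @[n --> \oo] --> (0 : R).
  apply: (weak_contraction_cvg0 psiP phiP) => n; last exact: pS.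
  exact: cross_dist_ge0.
have step0 : cross_dist (p n) (p n.+1) @[n --> \oo] --> (0 : R).
  apply: (weak_contraction_cvg0 psiP phiP) => n; last exact: pS.
  exact: cross_dist_ge0.
move/cvgrPdist_lt/(_ _ hdelta0): diag0 => [N1 _ N1P].
move/cvgrPdist_lt/(_ _ hdelta0): step0 => [N2 _ N2P].
pose N := maxn N1 N2; exists N => k.
have diag n : (N <= n)%N -> cross_dist (p n) (p n) < delta / 2.
  move=> Nn; have /N1P /= : (N1 <= n)%N by apply: leq_trans Nn; exact: leq_maxl.
  by rewrite sub0r normrN ger0_norm ?cross_dist_ge0.
have step : cross_dist (p N) (p N.+1) < delta / 2.
  have /N2P /= : (N2 <= N)%N by exact: leq_maxr.
  by rewrite sub0r normrN ger0_norm ?cross_dist_ge0.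
suff : cross_dist (p N) (p (N + k)%N) < e / 2 + delta by lra.
elim: k => [|k IHk]; first by have := diag N (leqnn N); rewrite addn0; lra.
have : cross_dist (p N.+1) (p (N + k).+1) < e / 2.
  by apply: mk0 (pS _ _); rewrite ?cross_dist_ge0//; lra.
have := cross_dist_triangle (p N) (p N.+1) (p (N + k).+1).
by have := diag N.+1 (leqnSn N); rewrite addnS; lra.
Qed.

(** A sequence of pairs whose crossed gauge contracts has converging first
    coordinates, and the second coordinates follow them: d x_N x_(N+k) is at
    most d x_N y_(N+k) + d y_(N+k) x_(N+k), and d y_n x_n tends to 0. *)
Lemma cross_contraction_cvg (R : realType) (X : completeMetricType R)
    (psi phi : R -> R) (p : nat -> X * X) :
  altering_distance psi -> altering_distance phi ->
  (forall m n, psi (cross_dist (p m.+1) (p n.+1)) <=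
    psi (cross_dist (p m) (p n)) - phi (cross_dist (p m) (p n))) ->
  exists x : X, (p n).1 @[n --> \oo] --> x /\ (p n).2 @[n --> \oo] --> x.
Proof.
move=> psiP phiP pS.
have diag0 : cross_dist (p n) (p n) @[n --> \oo] --> (0 : R).
  apply: (weak_contraction_cvg0 psiP phiP) => n; last exact: pS.
  exact: cross_dist_ge0.
have diag_near (e : R) : 0 < e ->
    \forall n \near \oo, mdist (p n).1 (p n).2 < e.
  move=> e0; move/cvgrPdist_lt/(_ _ e0): diag0; apply: filterS => n /=.
  rewrite sub0r normrN ger0_norm ?cross_dist_ge0//; apply: le_lt_trans.
  by rewrite le_max lexx.
have fst_cvg : cvg ((p n).1 @[n --> \oo]).
  apply: cauchy_cvg; apply: cauchy_exP => e e0.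
  have he0 : 0 < e / 2 by lra.
  have [N NP] := cross_orbit_bound psiP phiP pS he0.
  exists (p N).1; suff : \forall n \near \oo, ball (p N).1 e (p n).1 by [].
  near=> n; rewrite ballEmdist /=.
  have Nn : (N <= n)%N by near: n; exact: nbhs_infty_ge.
  have diagn : mdist (p n).1 (p n).2 < e / 2 by near: n; exact: diag_near.
  have := NP (n - N)%N; rewrite subnKC// gt_max => /andP[cross_n _].
  have := metric_triangle (p N).1 (p n).2 (p n).1.
  by rewrite (metric_sym (p n).2); lra.
exists (lim ((p n).1 @[n --> \oo])); split=> //.
apply/cvg_ballP => e e0; have he0 : 0 < e / 2 by lra.
have /cvg_ballP/(_ _ he0) fst_near := fst_cvg.
near=> n; rewrite ballEmdist /=.
have diagn : mdist (p n).1 (p n).2 < e / 2 by near: n; exact: diag_near.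
have : ball (lim ((p n).1 @[n --> \oo])) (e / 2) (p n).1.
  by near: n; exact: fst_near.
rewrite ballEmdist /= => fstn.
have := metric_triangle (lim ((p n).1 @[n --> \oo])) (p n).1 (p n).2.
by lra.
Unshelve. all: by end_near. Qed.

(** * The strong coupled fixed point *)

Theorem theorem2p2p2 (R : realType) (X : completeMetricType R)
    (A B : set X) (F : X -> X -> X)
    (A_neq0 : A !=set0) (B_neq0 : B !=set0)
    (A_closed : closed A) (B_closed : closed B)
    (F_contr : contraction_type_coupling A B F) :
  A `&` B !=set0 /\
  exists! x : X, (A `&` B) x /\ strong_coupled_fixed_point F x.
Proof.
case: F_contr => FAB [psi [phi [psiP phiP Fpsi]]].
have [a Aa] := A_neq0; have [b Bb] := B_neq0.
pose p := coupling_orbit F (a, b).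
have p_in n : A (p n).1 /\ B (p n).2 by exact: coupling_orbit_in.
have pS m n : psi (cross_dist (p m.+1) (p n.+1)) <=
    psi (cross_dist (p m) (p n)) - phi (cross_dist (p m) (p n)).
  have [mA mB] := p_in m; have [nA nB] := p_in n.
  exact: (cross_contraction Fpsi).
have [x [p1_cvg p2_cvg]] := cross_contraction_cvg psiP phiP pS.
have Ax : A x by apply: (closed_cvg A A_closed _ x p1_cvg);
  apply: nearW => n; have [] := p_in n.
have Bx : B x by apply: (closed_cvg B B_closed _ x p2_cvg);
  apply: nearW => n; have [] := p_in n.
(* x belongs to both sets, so the contraction applies to F x x and
   F y_n x_n = x_(n+1): the latter tends to F x x as well as to x. *)
have Fxx : F x x = x.
  apply: (cvg_unique (@metric_hausdorff R X) (F := (p n.+1).1 @[n --> \oo])).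
    apply/cvg_ballP => e e0; near=> n.
    have : ball x e (p n).1 by near: n; move/cvg_ballP: p1_cvg; apply.
    have : ball x e (p n).2 by near: n; move/cvg_ballP: p2_cvg; apply.
    rewrite !ballEmdist /= => x2 x1; have [nA nB] := p_in n.
    have max_lt : Num.max (mdist x (p n).2) (mdist x (p n).1) < e.
      by rewrite gt_max x2 x1.
    apply: le_lt_trans max_lt.
    apply: (weak_contraction_le psiP phiP); rewrite ?mdist_ge0 ?le_max//.
      by rewrite mdist_ge0.
    exact: Fpsi.
  by move: p1_cvg; rewrite -(cvg_shiftS (fun n => (p n).1)).
split; first by exists x.
exists x; split; first by [].
move=> u [[Au Bu] [Fuu _]].
have := Fpsi x x u u Ax Bx Bu Au; rewrite Fxx Fuu maxxx => xu.
have xu_ge0 : 0 <= mdist x u by exact: mdist_ge0.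
have phi_ge0 := altering_ge0 phiP xu_ge0.
apply: mdist_positivity; apply/(altering_eq0 phiP xu_ge0); lra.
Unshelve. all: by end_near. Qed.
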